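(* Let $\underline{x}_i,\overline{x}_i$ be real numbers with $0<\underline{x}_i<\overline{x}_i$ for all $i\in\{1,\dots,n\}$. For $k\in K$ and $j\in C_k^-$, let $\underline{\gamma}_{jk},\overline{\gamma}_{jk}$ be the monomial bounds determined by these variable bounds (defined in the context), and assume $\underline{\gamma}_{jk}<\overline{\gamma}_{jk}$. Define $$S^{\gamma}_{jk}=\Big\{(\tilde{\gamma}_{jk},\gamma_{jk})\in\mathbb{R}^2:\ \gamma_{jk}\le e^{\tilde{\gamma}_{jk}},\ \underline{\gamma}_{jk}\le\gamma_{jk}\le\overline{\gamma}_{jk},\ \log\underline{\gamma}_{jk}\le\tilde{\gamma}_{jk}\le\log\overline{\gamma}_{jk}\Big\}$$ and $$R^{\gamma}_{jk}=\Big\{(\tilde{\gamma}_{jk},\gamma_{jk})\in\mathbb{R}^2:\ \gamma_{jk}\le\frac{\overline{\gamma}_{jk}-\underline{\gamma}_{jk}}{\log\overline{\gamma}_{jk}-\log\underline{\gamma}_{jk}}(\tilde{\gamma}_{jk}-\log\underline{\gamma}_{jk})+\underline{\gamma}_{jk},\ \ \tilde{\gamma}_{jk}\le\log\overline{\gamma}_{jk},\ \ \underline{\gamma}_{jk}\le\gamma_{jk}\Big\}.$$ Then $R^{\gamma}_{jk}$ is the convex hull of $S^{\gamma}_{jk}$, for all such $j\in C_k^-$, $k\in K$.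
   Context: $K=\{0,1,\dots,p\}$ indexes the constraints of a signomial program, and for each $k\in K$, $C_k^-$ is a finite index set of monomials $\prod_i x_i^{a_{ijk}}$ (those with negative coefficient in constraint $k$), with real exponents $a_{ijk}$. The variable $\gamma_{jk}$ stands for the value of the monomial $\prod_i x_i^{a_{ijk}}$. For $j\in C_k^-$ let $A^+(j)=\{i\in\{1,\dots,n\}: a_{ijk}\ge 0\}$ and $A^-(j)=\{i\in\{1,\dots,n\}: a_{ijk}<0\}$, and define $$\underline{\gamma}_{jk}=\prod_{i\in A^+(j)}\underline{x}_i^{a_{ijk}}\prod_{i\in A^-(j)}\overline{x}_i^{a_{ijk}},\qquad \overline{\gamma}_{jk}=\prod_{i\in A^+(j)}\overline{x}_i^{a_{ijk}}\prod_{i\in A^-(j)}\underline{x}_i^{a_{ijk}}.$$ $\log$ denotes the natural logarithm. *)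

(* Defs.v *)
From HB Require Import structures.
From mathcomp Require Import all_boot all_order all_algebra.
From mathcomp Require Import all_classical all_reals all_analysis.
Set Implicit Arguments.
Unset Strict Implicit.
Unset Printing Implicit Defensive.
Import Order.TTheory GRing.Theory Num.Theory.
Local Open Scope classical_set_scope.
Local Open Scope ring_scope.

Definition convex_hull (R : numDomainType) (M : lmodType R) (A : set M) :
  set M := smallest (@convex_set R M) A.

Section SignomialBounds.
Variables (R : realType) (n p : nat) (J : finType).
(* [a i j k] is the exponent of x_i in monomial j of constraint k;
   constraints are numbered 0, ..., p. *)
Variables (a : 'I_n -> J -> 'I_p.+1 -> R) (xl xu : 'I_n -> R).
Variables (j : J) (k : 'I_p.+1).

Definition Aplus : {set 'I_n} := [set i | 0 <= a i j k]%SET.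
Definition Aminus : {set 'I_n} := [set i | a i j k < 0]%SET.

Definition gamma_lb : R :=
  (\prod_(i in Aplus) xl i `^ a i j k) * (\prod_(i in Aminus) xu i `^ a i j k).

Definition gamma_ub : R :=
  (\prod_(i in Aplus) xu i `^ a i j k) * (\prod_(i in Aminus) xl i `^ a i j k).

(* Points are pairs (log-variable, monomial variable). *)
Definition S_gamma : set (R * R) :=
  [set z | [/\ z.2 <= expR z.1,
               gamma_lb <= z.2 <= gamma_ub &
               ln gamma_lb <= z.1 <= ln gamma_ub]].

Definition R_gamma : set (R * R) :=
  [set z | [/\ z.2 <= (gamma_ub - gamma_lb) / (ln gamma_ub - ln gamma_lb)
                        * (z.1 - ln gamma_lb) + gamma_lb,
               z.1 <= ln gamma_ub &
               gamma_lb <= z.2]].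

End SignomialBounds.

(* Main.v *)
Require Import Defs.
From HB Require Import structures.
From mathcomp Require Import all_boot all_order all_algebra.
From mathcomp Require Import all_classical all_reals all_analysis.
From mathcomp Require Import ring lra.
Import Order.TTheory GRing.Theory Num.Theory.
Local Open Scope classical_set_scope.
Local Open Scope ring_scope.

(** The set R_gamma is the triangle whose vertices are the endpoints (ln l, l)
    and (ln u, u) of an arc of the graph of exp and the corner (ln u, l), where
    l < u are the two monomial bounds: the slope of its first constraint is that
    of the chord joining the two endpoints.

    S_gamma lies in the triangle because exp is convex, so that its graph stays
    below the chord on [ln l, ln u] ([expR_le_chord]); as the triangle is an
    intersection of three half-planes ([convex_triangle]), it contains the
    convex hull of S_gamma. Conversely the three vertices belong to S_gamma, and
    every point of the triangle is a barycentre of them ([triangle_sub]), so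
    every convex set containing S_gamma contains the triangle.

    Positivity of the bounds on the variables gives l > 0, hence exp (ln l) = l
    and exp (ln u) = u: the endpoints do lie on the graph of exp. *)

(** Replaces the bundled coefficients in [0, 1] and the boolean membership of
    [convex_set] by plain inequalities and propositions. *)
Lemma convex_setP {R : numDomainType} {M : lmodType R} (A : set M) :
  convex_set A <->
  forall (x y : M) (t : R), 0 <= t <= 1 -> A x -> A y ->
    A (t *: x + (1 - t) *: y).
Proof.
split=> [cA x y t /andP[t0 t1] Ax Ay|cA x y t].
  by have /set_mem := cA x y (Itv01 t0 t1) (mem_set Ax) (mem_set Ay).
rewrite !inE => Ax Ay.
by apply: cA => //; apply/andP; split.
Qed.

(** The barycentre a x + b y + c z is the combination of x, with coefficient a,
    and of the barycentre of y and z with the renormalized coefficients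
    b / (1 - a) and c / (1 - a). *)
Lemma convex_set3 (R : numFieldType) (M : lmodType R) (A : set M)
    (x y z : M) (a b c : R) :
  convex_set A -> A x -> A y -> A z ->
  0 <= a -> 0 <= b -> 0 <= c -> a + b + c = 1 ->
  A (a *: x + b *: y + c *: z).
Proof.
move=> /convex_setP cA Ax Ay Az a0 b0 c0 abc.
have bcE : b + c = 1 - a by rewrite -abc; ring.
(* Renormalization fails at a = 1, where the barycentre is x itself. *)
have [a1|a1] := eqVneq a 1.
  have /eqP : b + c = 0 by rewrite bcE a1 subrr.
  rewrite paddr_eq0// => /andP[/eqP-> /eqP->].
  by rewrite a1 !scale0r !addr0 scale1r.
have na0 : 1 - a != 0 by rewrite subr_eq0 eq_sym.
have na_gt0 : 0 < 1 - a by rewrite lt_neqAle eq_sym na0 -bcE addr_ge0.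
have -> : a *: x + b *: y + c *: z =
    a *: x + (1 - a) *: ((b / (1 - a)) *: y + (1 - b / (1 - a)) *: z).
  rewrite scalerDr !scalerA addrA; congr (_ + _ *: _ + _ *: _).
    by rewrite mulrC divfK.
  by rewrite mulrBr mulr1 mulrC divfK// -bcE addrC addKr.
apply: (cA) => //; first by rewrite a0 -subr_ge0 ltW.
apply: cA => //; apply/andP; split; first by rewrite divr_ge0// ltW.
by rewrite ler_pdivrMr// mul1r -bcE lerDl.
Qed.

Lemma convex_halfplane (R : realFieldType) (c1 c2 d : R) :
  @convex_set R (R^o * R^o)%type [set z | c1 * z.1 + c2 * z.2 <= d].
Proof.
apply/convex_setP => -[x1 x2] [y1 y2] t /andP[t0 t1] /= hx hy.
rewrite /GRing.scale/=.
have t1' : 0 <= 1 - t by rewrite subr_ge0.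
have := ler_wpM2l t0 hx; have := ler_wpM2l t1' hy.
lra.
Qed.

Lemma convex_setI {R : numDomainType} {M : lmodType R} (A B : set M) :
  convex_set A -> convex_set B -> convex_set (A `&` B).
Proof.
move=> /convex_setP cA /convex_setP cB; apply/convex_setP => x y t t01.
by move=> [Ax Bx] [Ay By]; split; [exact: cA | exact: cB].
Qed.

(** The chord at x is the combination of expR a and expR b with the coefficients
    that express x in terms of a and b, so this is the convexity of expR. *)
Lemma expR_le_chord {R : realType} {a b x : R} : a < b -> a <= x <= b ->
  expR x <= (expR b - expR a) / (b - a) * (x - a) + expR a.
Proof.
move=> ab /andP[ax xb].
have ba : 0 < b - a by rewrite subr_gt0.
have t0 : 0 <= (x - a) / (b - a) by rewrite divr_ge0 ?subr_ge0// ltW.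
have t1 : (x - a) / (b - a) <= 1 by rewrite ler_pdivrMr// mul1r lerB.
set t := (x - a) / (b - a) in t0 t1 *.
have : expR (t * b + (1 - t) * a) <= t * expR b + (1 - t) * expR a.
  exact: (convex_expR (Itv01 t0 t1) b a).
rewrite /t; have -> : (x - a) / (b - a) * b + (1 - (x - a) / (b - a)) * a = x.
  by field; rewrite gt_eqF.
move=> /le_trans; apply; rewrite le_eqVlt; apply/orP; left; apply/eqP.
by field; rewrite gt_eqF.
Qed.

Lemma gamma_lb_gt0 {R : realType} {n p : nat} {J : finType}
    (a : 'I_n -> J -> 'I_p.+1 -> R) {xl xu : 'I_n -> R} (j : J) (k : 'I_p.+1) :
  (forall i, 0 < xl i) -> (forall i, 0 < xu i) -> 0 < gamma_lb a xl xu j k.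
Proof.
by move=> l0 u0; rewrite mulr_gt0// prodr_gt0// => i _; rewrite powR_gt0.
Qed.

(** The solid triangle with vertices (a, l), (b, u) and (b, l), for a < b and
    l < u, in the form that R_gamma takes at a = ln l and b = ln u. *)
Definition triangle {R : realFieldType} (a b l u : R) : set (R * R) :=
  [set z | [/\ z.2 <= (u - l) / (b - a) * (z.1 - a) + l, z.1 <= b & l <= z.2]].

Lemma convex_triangle (R : realFieldType) (a b l u : R) :
  @convex_set R (R^o * R^o)%type (triangle a b l u).
Proof.
pose s := (u - l) / (b - a).
rewrite (_ : triangle a b l u =
  [set z | (- s) * z.1 + 1 * z.2 <= l - s * a] `&`
  ([set z | 1 * z.1 + 0 * z.2 <= b] `&`
   [set z | 0 * z.1 + (-1) * z.2 <= - l])); last first.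
  apply/seteqP; rewrite /triangle -/s; split => -[x y] /=.
    by move=> [h1 h2 h3]; split; [lra | split; lra].
  by move=> [h1 [h2 h3]]; split; lra.
by do 2![apply: convex_setI; first exact: convex_halfplane];
  exact: convex_halfplane.
Qed.

(** A point (x, y) has barycentric coordinates (b - x) / (b - a) at (a, l) and
    (y - l) / (u - l) at (b, u), because (a, l) is the only vertex off the line
    x = b and (b, u) the only one off the line y = l. These are nonnegative by
    the last two constraints of the triangle, and the chord constraint says that
    the remaining coordinate is nonnegative as well. *)
Lemma triangle_sub (R : realFieldType) (a b l u : R)
    (A : set (R^o * R^o)%type) : a < b -> l < u ->
  convex_set A -> A (a, l) -> A (b, u) -> A (b, l) -> triangle a b l u `<=` A.
Proof.
move=> ab lu cA Aal Abu Abl [x y] [/= ychord xb ly].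
have ba : 0 < b - a by rewrite subr_gt0.
have ul : 0 < u - l by rewrite subr_gt0.
set wa := (b - x) / (b - a); set wu := (y - l) / (u - l).
have wc : 0 <= 1 - wa - wu.
  have -> : 1 - wa - wu = (x - a) / (b - a) - wu.
    by rewrite /wa; field; rewrite gt_eqF.
  rewrite subr_ge0 ler_pdivrMr// mulrAC [leRHS]mulrC mulrA mulrAC -[leRHS]mulrA.
  lra.
have -> : (x, y) = wa *: ((a, l) : R^o * R^o) + wu *: ((b, u) : R^o * R^o)
    + (1 - wa - wu) *: ((b, l) : R^o * R^o).
  by congr pair; rewrite /= /GRing.scale/= /wa /wu; field; rewrite !gt_eqF.
apply: convex_set3 => //; last by ring.
- by rewrite divr_ge0 ?subr_ge0// ltW.
- by rewrite divr_ge0 ?subr_ge0// ltW.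
Qed.

Theorem proposition3 (R : realType) (n p : nat) (J : finType)
    (Cminus : 'I_p.+1 -> {set J})
    (a : 'I_n -> J -> 'I_p.+1 -> R) (xl xu : 'I_n -> R)
    (hx : forall i : 'I_n, 0 < xl i /\ xl i < xu i) :
  forall (k : 'I_p.+1) (j : J), j \in Cminus k ->
    gamma_lb a xl xu j k < gamma_ub a xl xu j k ->
    R_gamma a xl xu j k =
      convex_hull (M := (R^o * R^o)%type) (S_gamma a xl xu j k).
Proof.
move=> k j _ lu.
have xl0 i : 0 < xl i by case: (hx i).
have xu0 i : 0 < xu i by case: (hx i); exact: lt_trans.
have := gamma_lb_gt0 a j k xl0 xu0.
rewrite /R_gamma /S_gamma.
move: (gamma_lb a xl xu j k) (gamma_ub a xl xu j k) lu => l u lu l0.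
have u0 : 0 < u by exact: lt_trans lu.
have lnlu : ln l < ln u by rewrite ltr_ln// posrE.
rewrite -/(triangle (ln l) (ln u) l u); apply/seteqP; split.
  move=> z Tz A [cA SA]; apply: triangle_sub Tz => //; apply: SA => /=;
    by rewrite lnK ?posrE// !lexx (ltW lu) (ltW lnlu).
apply: smallest_sub; first exact: convex_triangle.
move=> [x y] /= [yx /andP[ly yu] /andP[lx xu']]; split => //=.
have /(expR_le_chord lnlu) : ln l <= x <= ln u by rewrite lx.
by rewrite !lnK//; exact: le_trans.
Qed.
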